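(* Let $G$ be a finite graph with no loops and no parallel edges, and let $M$ be the graphic matroid of $G$. Then $M$ has a unique (inclusion-)minimal tropical basis, namely the collection of the induced cycles of $G$.
   Context: The graphic matroid of $G$ has the edge set of $G$ as ground set, and its circuits are the edge sets of cycles of $G$ (closed walks all of whose vertices have degree two in the cycle). An induced cycle of $G$ is an induced subgraph of $G$ that is itself a cycle (identified here with its edge set). For a matroid with ground set $[n]$ and collection of circuits $\mathcal{C}$: let $\mathbb{T} = \mathbb{R} \cup \{\infty\}$ and $\mathbb{TP}^{n-1} = (\mathbb{T}^n \setminus \{(\infty,\dots,\infty)\})/\mathbb{R}(1,\dots,1)$. For a circuit $C$ let $\mathcal{T}(C)$ be the set of points $x \in \mathbb{TP}^{n-1}$ such that the minimum of $\{x_i : i \in C\}$ is attained at least twice, i.e. by at least two distinct indices $i \in C$ (this includes the case where all $x_i$, $i\in C$, are $\infty$). For $\mathcal{B} \subset \mathcal{C}$ let $\mathcal{T}(\mathcal{B}) = \bigcap_{C \in \mathcal{B}} \mathcal{T}(C)$. A subset $\mathcal{B} \subset \mathcal{C}$ is a tropical basis if $\mathcal{T}(\mathcal{B}) = \mathcal{T}(\mathcal{C})$. *)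

(* Defs.v *)
From HB Require Import structures.
From mathcomp Require Import all_boot all_order all_algebra generic_quotient.
From mathcomp Require Import boolp classical_sets reals constructive_ereal.

Set Implicit Arguments.
Unset Strict Implicit.
Unset Printing Implicit Defensive.

Import Order.TTheory GRing.Theory Num.Theory.

Local Open Scope classical_set_scope.
Local Open Scope quotient_scope.

Record matroid (E : finType) := Matroid {
  circuits : set {set E};
  circuits0 : ~ circuits finset.set0;
  circuits_antichain : forall C D : {set E},
    circuits C -> circuits D -> C \subset D -> C = D;
  circuits_elim : forall (C D : {set E}) (f : E),
    circuits C -> circuits D -> C <> D -> f \in C -> f \in D ->
    exists2 C' : {set E}, circuits C' & C' \subset (C :|: D) :\ f }.

Section TropicalProjectiveSpace.
Local Open Scope ereal_scope.
Variables (R : realType) (E : finType).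

Definition trop := {x : \bar R | x != -oo}.

Definition trop_cone := {x : {ffun E -> trop} | [exists i, val (x i) != +oo]}.

Definition coord (x : trop_cone) (i : E) : \bar R := val (val x i).

Definition trop_equiv (x y : trop_cone) : bool :=
  `[< exists c : R, forall i : E, coord y i = coord x i + c%:E >].

Lemma trop_equiv_refl : reflexive trop_equiv.
Proof. by move=> x; apply/asboolP; exists 0%R => i; rewrite adde0. Qed.

Lemma trop_equiv_sym : symmetric trop_equiv.
Proof.
suff h x y : trop_equiv x y -> trop_equiv y x.
  by move=> x y; apply/idP/idP; exact: h.
move=> /asboolP[c xy]; apply/asboolP; exists (- c)%R => i.
by rewrite xy -addeA -EFinD subrr adde0.
Qed.

Lemma trop_equiv_trans : transitive trop_equiv.
Proof.
move=> y x z /asboolP[c xy] /asboolP[d yz]; apply/asboolP.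
by exists (c + d)%R => i; rewrite yz xy EFinD addeA.
Qed.

Canonical trop_equiv_rel :=
  EquivRel trop_equiv trop_equiv_refl trop_equiv_sym trop_equiv_trans.

Definition TP := {eq_quot trop_equiv}.

Definition min_attained_twice (C : {set E}) (x : trop_cone) :=
  exists i j : E, [/\ i \in C, j \in C, i != j,
    forall k, k \in C -> coord x i <= coord x k &
    forall k, k \in C -> coord x j <= coord x k].

Definition trop_circuit (C : {set E}) : set TP :=
  [set p | exists2 x : trop_cone, p = \pi x & min_attained_twice C x].

(* The condition does not depend on the chosen homogeneous coordinates. *)
Lemma trop_circuitE (C : {set E}) (x : trop_cone) :
  trop_circuit C (\pi x) <-> min_attained_twice C x.
Proof.
split=> [[y /eqmodP /asboolP[c xy] [i [j [iC jC ij hi hj]]]]|hx]; last by exists x.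
exists i, j; split => // k kC.
  by have := hi k kC; rewrite !xy leeD2rE.
by have := hj k kC; rewrite !xy leeD2rE.
Qed.

Definition trop_variety (B : set {set E}) : set TP :=
  \bigcap_(C in B) trop_circuit C.

End TropicalProjectiveSpace.

Arguments trop_variety R {E} B.

Section TropicalBasis.
Variables (R : realType) (E : finType) (M : matroid E).

Definition tropical_basis (B : set {set E}) :=
  B `<=` circuits M /\ trop_variety R B = trop_variety R (circuits M).

Definition minimal_tropical_basis (B : set {set E}) :=
  tropical_basis B /\
  forall B' : set {set E}, tropical_basis B' -> B' `<=` B -> B' = B.

End TropicalBasis.

Arguments tropical_basis R {E} M B.
Arguments minimal_tropical_basis R {E} M B.

Record sgraph := SGraph {
  vertex :> finType;
  adj : rel vertex;
  adj_sym : symmetric adj;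
  adj_irrefl : irreflexive adj }.

Section Graph.
Variable G : sgraph.
Implicit Types (p : seq G) (W : {set G}).

Definition is_edge (f : {set G}) : bool :=
  [exists x, exists y, adj x y && (f == [set x; y]%SET)].

Definition edge := {f : {set G} | is_edge f}.
Implicit Types (F : {set edge}).

(* A sequence p = [:: x_0; ...; x_(k-1)] with cycle (@adj G) p encodes the
   closed walk x_0, ..., x_(k-1), x_0. *)
Definition walk_edges p : {set edge} :=
  [set f : edge |
    val f \in [seq [set xy.1; xy.2]%SET | xy <- zip p (rot 1 p)]]%SET.

Definition edges_at F (x : G) : {set edge} := [set f in F | x \in val f]%SET.

(* The subgraph with vertex set W and edge set F is a cycle. Degrees count
   distinct edges, so the walk x, y, x is not a cycle. *)
Definition is_cycle W F :=
  exists p, [/\ p != [::], cycle (@adj G) p, W = [set x in p]%SET,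
    F = walk_edges p & forall x, x \in p -> #|edges_at F x| = 2].

Definition cycle_edge_sets : set {set edge} :=
  [set F | exists W, is_cycle W F].

Definition induced_edges W : {set edge} :=
  [set f : edge | val f \subset W]%SET.

Definition induced_cycles : set {set edge} :=
  [set F | exists2 W, is_cycle W (induced_edges W) & F = induced_edges W].

Lemma mem_zip_rot p x y : uniq p ->
  ((x, y) \in zip p (rot 1 p)) = (x \in p) && (y == next p x).
Proof.
case: p => // a p Up; rewrite rot1_cons.
have sz : size (a :: p) = size (rcons p a) by rewrite size_rcons.
apply/idP/andP => [/(nthP (a, a))[i]|[xp /eqP->]].
  rewrite size_zip -sz minnn => lti; rewrite nth_zip // => -[<- <-].
  have xin : nth a (a :: p) i \in a :: p by rewrite mem_nth.
  split=> //; rewrite next_nth xin index_uniq // nth_rcons.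
  by case: ltngtP => // h; rewrite ?if_same nth_default ?h //; apply: ltnW.
apply/(nthP (a, a)); exists (index x (a :: p)).
  by rewrite size_zip -sz minnn index_mem.
rewrite nth_zip // nth_index // next_nth xp; congr pair.
rewrite nth_rcons.
by case: ltngtP => // h; rewrite ?if_same nth_default ?h //; apply: ltnW.
Qed.

Lemma edgeP (x y : G) : adj x y -> exists f : edge, val f = [set x; y]%SET.
Proof.
move=> xy; have h : is_edge [set x; y]%SET.
  by apply/existsP; exists x; apply/existsP; exists y; rewrite xy eqxx.
by exists (exist (fun f : {set G} => is_edge f) _ h).
Qed.

Lemma set2_inj (T : finType) (x y z : T) :
  [set x; y]%SET = [set x; z]%SET -> y = z.
Proof.
move=> /setP h; have := h y; have := h z; rewrite !inE !eqxx !orbT.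
case: (eqVneq z x) => [->|_] /=; last by move/eqP.
by case: (eqVneq y x) => //= _ _ /esym/eqP.
Qed.

Lemma ucycle_is_cycle p : uniq p -> 2 < size p -> cycle (@adj G) p ->
  is_cycle [set x in p]%SET (walk_edges p).
Proof.
move=> Up sp cp; exists p; split=> // [|x xp]; first by case: (p) sp.
have nx : next p x \in p by rewrite mem_next.
have px : prev p x \in p by rewrite mem_prev.
have [f ef] := edgeP (next_cycle cp xp).
have [g eg] := edgeP (prev_cycle cp xp).
suff -> : edges_at (walk_edges p) x = [set f; g]%SET.
  rewrite cards2; case: eqVneq => // fg; exfalso.
  have /set2_inj e : [set x; next p x]%SET = [set x; prev p x]%SET.
    by rewrite -ef fg eg finset.setUC.
  have e2 : next p (next p x) = x by rewrite e next_prev.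
  have [i q eq] := rot_to xp.
  move: e2; have nE := next_rot i Up; rewrite -!nE eq.
  have : uniq (rot i p) by rewrite rot_uniq.
  have : size (rot i p) = size p by rewrite size_rot.
  rewrite {}eq; case: q => [|y [|z q]] /= sq; try by rewrite -sq in sp.
  rewrite !inE !negb_or => /andP[/and3P[xy xz _] _].
  rewrite eqxx (eq_sym y x) (negbTE xy) eqxx => zx.
  by rewrite zx eqxx in xz.
apply/finset.setP => h; rewrite !inE; apply/andP/orP.
  case=> /mapP[[a b]]; rewrite mem_zip_rot // => /andP[ap /eqP->] eh.
  rewrite eh !inE => /orP[/eqP xa|/eqP xa].
    by left; apply/eqP/val_inj; rewrite eh ef xa.
  by right; apply/eqP/val_inj; rewrite eh eg xa prev_next.
case=> /eqP->.
  rewrite ef !inE eqxx; split=> //; apply/mapP; exists (x, next p x) => //.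
  by rewrite mem_zip_rot // xp /=.
rewrite eg !inE eqxx orbT; split=> //; apply/mapP; exists (prev p x, x) => //.
by rewrite mem_zip_rot // px next_prev /=.
Qed.


Lemma is_cycle_neq0 W F : is_cycle W F -> F <> finset.set0.
Proof.
case=> p [p0 _ _ _ dF] F0; case: p p0 dF => // x p _ /(_ x).
rewrite F0 mem_head => /(_ isT).
rewrite (_ : edges_at _ _ = finset.set0) ?cards0 //.
by apply/finset.setP => h; rewrite !inE.
Qed.

Lemma edges_atS F F' x : F \subset F' -> edges_at F x \subset edges_at F' x.
Proof.
by move=> /fintype.subsetP FF'; apply/fintype.subsetP => h; rewrite !inE => /andP[/FF' -> ->].
Qed.

Lemma edge_ends (f : edge) : exists x y : G, adj x y /\ val f = [set x; y]%SET.
Proof.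
have /existsP[x /existsP[y /andP[xy /eqP fE]]] := valP f.
by exists x, y.
Qed.

Lemma mem_zip_ends p x y :
  (x, y) \in zip p (rot 1 p) -> (x \in p) && (y \in p).
Proof.
move=> xy; apply/andP; split.
  have := map_f fst xy; rewrite -[map _ _]/(unzip1 _).
  by rewrite unzip1_zip ?size_rot.
have := map_f snd xy; rewrite -[map _ _]/(unzip2 _).
by rewrite unzip2_zip ?size_rot // mem_rot.
Qed.

Lemma walk_edges_ends p (f : edge) x :
  f \in walk_edges p -> x \in val f -> x \in p.
Proof.
rewrite inE => /mapP[[a b] /mem_zip_ends/andP[ap bp] ->].
by rewrite !inE => /orP[] /eqP->.
Qed.

Lemma path_zip (r : rel G) x p :
  path r x p <-> (forall a b, (a, b) \in zip (x :: p) p -> r a b).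
Proof.
elim: p x => //= y p IH x; split=> [/andP[xy /IH h] a b|h].
  by rewrite inE => /orP[/eqP[-> ->]//|]; exact: h.
rewrite h ?mem_head //=.
by apply/IH => a b ab; apply: h; rewrite inE ab orbT.
Qed.

Lemma cycle_zip (r : rel G) p :
  cycle r p <-> (forall a b, (a, b) \in zip p (rot 1 p) -> r a b).
Proof.
case: p => // x p; rewrite rot1_cons.
have h (s t u : seq G) : size s = size t -> zip (s ++ u) t = zip s t.
  move=> e; have u0 : zip u ([::] : seq G) = [::] by case: (u).
  by rewrite -[in LHS](cats0 t) zip_cat // u0 cats0.
have <- : zip (x :: rcons p x) (rcons p x) = zip (x :: p) (rcons p x).
  by have /= := h (x :: p) (rcons p x) [:: x]; rewrite cats1 size_rcons; apply.
exact: path_zip.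
Qed.

Lemma path_closed (r : rel G) (A : pred G) x p :
  (forall a b, r a b -> A a -> A b) -> A x -> path r x p -> all A p.
Proof.
move=> h; elim: p x => //= y p IH x Ax /andP[/h/(_ Ax) Ay /(IH y Ay) ->].
by rewrite Ay.
Qed.

Lemma cycle_antichain F F' :
  cycle_edge_sets F -> cycle_edge_sets F' -> F \subset F' -> F = F'.
Proof.
move=> [W FC] [W' [q [q0 cq _ Fq dq]]] sFF'.
have F0 := is_cycle_neq0 FC; case: FC => p [p0 cp _ Fp dp].
have eqat x : x \in p -> x \in q -> edges_at F x = edges_at F' x.
  by move=> xp xq; apply/eqP; rewrite eqEcard edges_atS //= dp // dq.
have [f fF] : exists f, f \in F by apply/finset.set0Pn/eqP.
have [x [y [_ fE]]] := edge_ends f.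
have xf : x \in val f by rewrite fE !inE eqxx.
have xp : x \in p by apply: (@walk_edges_ends _ f) => //; rewrite -Fp.
have xq : x \in q.
  by apply: (@walk_edges_ends _ f) => //; rewrite -Fq; apply: (fintype.subsetP sFF').
have closed a b : (a, b) \in zip q (rot 1 q) -> a \in p -> b \in p.
  move=> ab ap; have /andP[aq bq] := mem_zip_ends ab.
  have /edgeP[g gE] : adj a b.
    exact: (cycle_zip _ _).1 ab.
  have gF' : g \in F'.
    by rewrite Fq inE gE; apply/mapP; exists (a, b).
  have : g \in edges_at F' a by rewrite inE gF' gE !inE eqxx.
  rewrite -eqat // inE Fp => /andP[gF _].
  by apply: walk_edges_ends gF _; rewrite gE !inE eqxx orbT.
have qp a : a \in q -> a \in p.
  have [i s qE] := rot_to xq.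
  rewrite -(mem_rot i) qE inE => /orP[/eqP->//|as_].
  have : cycle (fun a b => (a, b) \in zip q (rot 1 q)) q by apply/cycle_zip.
  rewrite -(rot_cycle i) qE /= rcons_path => /andP[pth _].
  by have /allP := path_closed closed xp pth; apply.
apply/eqP; rewrite finset.eqEsubset sFF' /=; apply/fintype.subsetP => g gF'.
have [a [b [_ gE]]] := edge_ends g.
have ag : a \in val g by rewrite gE !inE eqxx.
have aq : a \in q by apply: (@walk_edges_ends _ g) => //; rewrite -Fq.
have : g \in edges_at F' a by rewrite inE gF' ag.
by rewrite -eqat ?qp // inE => /andP[].
Qed.

Lemma exists_cycle F : F <> finset.set0 ->
  (forall x, #|edges_at F x| != 1) ->
  exists2 F', cycle_edge_sets F' & F' \subset F.
Proof.
move=> F0 dF.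
pose r x y := [exists f in F, val f == [set x; y]%SET].
have r_sym x y : r x y = r y x by rewrite /r finset.setUC.
have r_adj x y : r x y -> adj x y.
  move=> /exists_inP[f fF /eqP fE]; have [a [b [ab]]] := edge_ends f.
  rewrite fE => e; have xa : x \in [set a; b]%SET by rewrite -e !inE eqxx.
  move: xa; rewrite !inE => /orP[]/eqP xa; subst x.
    by rewrite (set2_inj e).
  by move: e; rewrite [[set a; b]%SET]finset.setUC => /set2_inj ->; rewrite adj_sym.
have finish p : uniq p -> 2 < size p -> cycle r p ->
    exists2 F', cycle_edge_sets F' & F' \subset F.
  move=> Up sp cp; exists (walk_edges p).
    exists [set x in p]%SET; apply: ucycle_is_cycle => //.
    by apply: sub_cycle cp => x y /r_adj.
  apply/fintype.subsetP => f; rewrite inE => /mapP[[a b]].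
  rewrite mem_zip_rot // => /andP[ap /eqP->] fE.
  have /exists_inP[g gF /eqP gE] := next_cycle cp ap.
  by rewrite (val_inj (etrans fE (esym gE))).
have nbr x y : r x y -> exists2 z, z != y & r x z.
  move=> /exists_inP[f fF /eqP fE].
  have fx : f \in edges_at F x by rewrite inE fF fE !inE eqxx.
  have : 1 < #|edges_at F x|.
    by rewrite ltn_neqAle eq_sym dF; apply/card_gt0P; exists f.
  rewrite (cardsD1 f) fx ltnS => /card_gt0P[g]; rewrite !inE => /and3P[gf gF xg].
  have [a [b [_ gE]]] := edge_ends g.
  have [z gE'] : exists z, val g = [set x; z]%SET.
    move: xg; rewrite gE !inE => /orP[]/eqP->; first by exists b.
    by exists a; rewrite finset.setUC.
  exists z; last by apply/exists_inP; exists g => //; apply/eqP.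
  by apply: contraNneq gf => zy; apply/eqP/val_inj; rewrite fE gE' zy.
have grow n : forall y x p, uniq [:: y, x & p] -> path r y (x :: p) ->
    #|G| <= size p + n -> exists2 F', cycle_edge_sets F' & F' \subset F.
  elim: n => [|n IH] y x p Up pth sz.
    have := card_uniqP Up; have := max_card (mem [:: y, x & p]).
    move=> le1 e; move: le1; rewrite e /= leqNgt.
    by rewrite addn0 in sz; rewrite ltnS (leq_trans sz).
  have /nbr[z zx yz] : r y x by case/andP: pth.
  have zy : z != y.
    by apply: contraTneq yz => ->; apply/negP => /r_adj; rewrite adj_irrefl.
  case: (boolP (z \in p)) => zp; last first.
    apply: (IH z y (x :: p)); last by rewrite /= addSnnS.
      by rewrite cons_uniq Up andbT !inE !negb_or zy zx.
    by rewrite /= r_sym yz.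
  have [i [s pE]] : exists p1 p2, p = p1 ++ z :: p2.
    by case/splitPr: zp => p1 p2; exists p1, p2.
  apply: (finish (y :: x :: rcons i z)); last 1 first.
  - move: pth; rewrite pE -cat_rcons /= cat_path rcons_path last_rcons.
    by rewrite !rcons_path last_rcons => /and3P[-> -> _] /=; rewrite r_sym.
  - by move: Up; rewrite pE -cat_rcons -2!cat_cons cat_uniq => /andP[].
  - by rewrite /= size_rcons.
have [f fF] : exists f, f \in F by apply/finset.set0Pn/eqP.
have [x [y [xy fE]]] := edge_ends f.
apply: (grow #|G| x y [::]); rewrite ?leq_addl //=.
  by rewrite !inE andbT; apply: contraTneq xy => ->; rewrite adj_irrefl.
by rewrite andbT; apply/exists_inP; exists f => //; apply/eqP.
Qed.

Lemma even_cycle_degree F x : cycle_edge_sets F -> ~~ odd #|edges_at F x|.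
Proof.
move=> [W [p [_ _ _ Fp dp]]]; case: (boolP (x \in p)) => [/dp ->//|xp].
suff -> : edges_at F x = finset.set0 by rewrite cards0.
apply/finset.setP => f; rewrite !inE Fp; apply/negP => /andP[fF xf].
by rewrite (walk_edges_ends fF xf) in xp.
Qed.

Lemma cycle_elim F F' (f : edge) :
  cycle_edge_sets F -> cycle_edge_sets F' -> F <> F' -> f \in F -> f \in F' ->
  exists2 F'', cycle_edge_sets F'' & F'' \subset ((F :|: F') :\ f)%SET.
Proof.
move=> cF cF' FF' fF fF'; pose D := ((F :\: F') :|: (F' :\: F))%SET.
have [||F'' cF'' sF''] := @exists_cycle D.
- move=> D0; apply: FF'; apply/finset.setP => g.
  by move/finset.setP: D0 => /(_ g); rewrite !inE; case: (g \in F); case: (g \in F').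
- move=> x; apply: contraNneq (even_cycle_degree x cF) => D1.
  have := even_cycle_degree x cF'.
  have DE : edges_at D x = ((edges_at F x :\: edges_at F' x) :|:
      (edges_at F' x :\: edges_at F x))%SET.
    apply/finset.setP => g; rewrite !inE.
    by case: (g \in F); case: (g \in F'); case: (x \in val g).
  have dis : ((edges_at F x :\: edges_at F' x) :&:
      (edges_at F' x :\: edges_at F x))%SET = finset.set0.
    apply/finset.setP => g; rewrite !inE.
    by case: (g \in F); case: (g \in F'); case: (x \in val g).
  move: D1; rewrite DE cardsU dis cards0 subn0.
  rewrite -(cardsID (edges_at F' x) (edges_at F x)).
  rewrite -(cardsID (edges_at F x) (edges_at F' x)) finset.setIC.
  move=> /(congr1 odd); rewrite !oddD /=.
  by do 3!case: (odd _).
exists F'' => //; apply: fintype.subset_trans sF'' _; apply/fintype.subsetP => g.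
rewrite !inE; case: eqVneq => [->|_]; first by rewrite fF fF'.
by case: (g \in F); case: (g \in F').
Qed.

Lemma cycle_neq0 : ~ cycle_edge_sets finset.set0.
Proof. by move=> [W /is_cycle_neq0]. Qed.

Definition graphic_matroid : matroid edge :=
  Matroid cycle_neq0 cycle_antichain cycle_elim.

End Graph.

Arguments cycle_edge_sets G : clear implicits.
Arguments induced_cycles G : clear implicits.
Arguments graphic_matroid G : clear implicits.

(* Main.v *)
Require Import Defs.
From mathcomp Require Import all_boot classical_sets reals.
From mathcomp Require Import order ssralg ssrnum generic_quotient.
From mathcomp Require Import boolp constructive_ereal zify.

(** Call a set of edges even if every vertex meets an even number of its
    edges: these sets form the cycle space of the graph over F_2, they are
    closed under symmetric difference, and cycles are even.  Two independent
    facts give the theorem.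

    Induced cycles suffice ([induced_tropical_basis]).  Let x be a weighting of
    the edges whose minimum over each induced cycle is attained twice.  By
    strong induction on the size, no even set K has an edge e that is strictly
    lighter than the rest of K ([even_no_strict_min]).  If K properly contains
    a cycle C, then e lies in C or in K minus C, both smaller and even.
    Otherwise K is a cycle; if it is not induced it has a chord f, and closing
    with f a path of K between the ends of f gives a cycle K1 inside K + f
    ([chord_cycle]).  Let K2 be the symmetric difference of K and K1.  Both K1
    and K2 contain f, each edge of K lies in exactly one of them, so their sizes
    add up to |K| + 2; as a nonempty even set has at least three edges in a
    simple graph ([even_card]), both are smaller than K.  Say that e is in K1.
    The induction hypothesis gives in K1 an edge other than e that weighs at
    most x e.  If that edge is f, the induction hypothesis for f in K2 gives an
    edge of K2 other than f, hence in K and different from e, that weighs at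
    most x f, hence at most x e.  Arguing with even sets rather than cycles
    spares the proof that the chord splits K into exactly two cycles.

    Induced cycles are needed ([induced_sub_tropical_basis]).  Given an induced
    cycle C with an edge e, let x be 1 on C minus e and 0 elsewhere.  On C the
    minimum 0 is attained only at e.  Any other cycle has two edges outside C
    ([induced_cycle_two_outside]), where x is 0.  So x separates the tropical
    hypersurface of C from those of all other cycles, and C is in every
    tropical basis.

    Hence the induced cycles form the least tropical basis, which is therefore
    the only minimal one. *)

Set Implicit Arguments.
Unset Strict Implicit.
Unset Printing Implicit Defensive.

Import Order.TTheory.

(** * The cycle space *)

Definition symdiff (T : finType) (A B : {set T}) : {set T} :=
  (A :\: B) :|: (B :\: A).

Lemma in_symdiff (T : finType) (A B : {set T}) x :
  (x \in symdiff A B) = (x \in A) (+) (x \in B).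
Proof. by rewrite !inE; case: (x \in A); case: (x \in B). Qed.

Lemma card_symdiff (T : finType) (A B : {set T}) :
  #|symdiff A B| + #|A :&: B|.*2 = #|A| + #|B|.
Proof.
rewrite cardsU (_ : _ :&: _ = finset.set0) ?cards0 ?subn0; last first.
  by apply/setP => x; rewrite !inE; case: (x \in A); case: (x \in B).
rewrite -(cardsID B A) -(cardsID A B) (finset.setIC B A) -addnn.
by rewrite [LHS]addnACA ![#|_ :\: _| + #|_ :&: _|]addnC.
Qed.

Definition even_edge_set (G : sgraph) (F : {set edge G}) : Prop :=
  forall x, ~~ odd #|edges_at F x|.

Lemma even_symdiff (G : sgraph) (F F' : {set edge G}) :
  even_edge_set F -> even_edge_set F' -> even_edge_set (symdiff F F').
Proof.
move=> eF eF' x.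
have -> : edges_at (symdiff F F') x = symdiff (edges_at F x) (edges_at F' x).
  by apply/setP => g; rewrite inE !in_symdiff !inE; case: (x \in val g);
    rewrite ?andbT ?andbF.
have := congr1 odd (card_symdiff (edges_at F x) (edges_at F' x)).
rewrite !oddD odd_double addbF => ->.
by rewrite (negbTE (eF x)) (negbTE (eF' x)).
Qed.

Lemma cycle_even (G : sgraph) (F : {set edge G}) :
  cycle_edge_sets G F -> even_edge_set F.
Proof. by move=> cF x; exact: even_cycle_degree. Qed.

Lemma even_other_edge (G : sgraph) (F : {set edge G}) (f : edge G) x :
  even_edge_set F -> f \in F -> x \in val f ->
  exists g, [/\ g \in F, g != f & x \in val g].
Proof.
move=> eF fF xf; have := eF x.
rewrite (cardsD1 f) inE fF xf /= negbK => /odd_gt0 /card_gt0P[g].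
by rewrite !inE => /and3P[gf gF xg]; exists g.
Qed.

Lemma edge_eq (G : sgraph) (f g : edge G) (u v : G) :
  val f = [set u; v] -> u \in val g -> v \in val g -> f = g.
Proof.
move=> fE; have [a [b [_ gE]]] := edge_ends g.
have [c [d [cd fE']]] := edge_ends f.
have uv : u != v.
  have := congr1 (fun A : {set G} => #|A|) fE.
  rewrite /= fE' !cards2; case: eqVneq cd => [->|_ _]; first by rewrite adj_irrefl.
  by case: (u != v).
rewrite gE => ug vg; apply: val_inj; rewrite fE gE; apply/eqP.
rewrite eqEcard finset.subUset !finset.sub1set ug vg /= !cards2 uv.
by case: (a != b).
Qed.

(** Each end of an edge of an even set meets a second edge of the set, and these
    two further edges differ because there are no parallel edges. *)
Lemma even_card (G : sgraph) (F : {set edge G}) (f : edge G) :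
  even_edge_set F -> f \in F -> 2 < #|F|.
Proof.
move=> eF fF; have [u [v [_ fE]]] := edge_ends f.
have uf : u \in val f by rewrite fE !inE eqxx.
have vf : v \in val f by rewrite fE !inE eqxx orbT.
have [g [gF gf ug]] := even_other_edge eF fF uf.
have [h [hF hf vh]] := even_other_edge eF fF vf.
have gh : g != h.
  by apply: contra_neq gf => gh; apply/esym/(edge_eq fE ug); rewrite gh.
rewrite (cardsD1 f) fF (cardsD1 g) (cardsD1 h) !inE.
by rewrite gf gF (eq_sym h g) gh hf hF.
Qed.

(** * Reduction to induced cycles *)

(** A cycle is connected, so a simple path inside it joins the two ends of the
    chord; the chord closes that path to a cycle. *)
Lemma chord_cycle (G : sgraph) (W : {set G}) (F : {set edge G}) (f : edge G) :
  is_cycle W F -> f \in induced_edges W -> f \notin F ->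
  exists C, [/\ cycle_edge_sets G C, f \in C & C \subset f |: F].
Proof.
move=> [p [_ cp -> FE _]]; rewrite inE => fW fF.
have [u [v [uv fE]]] := edge_ends f.
move: fW; rewrite fE finset.subUset !finset.sub1set !inE => /andP[up vp].
pose r a b := [exists g in F, val g == [set a; b]].
have r_adj a b : r a b -> adj a b.
  move=> /exists_inP[g _ /eqP gE]; have [c [d [cd gE']]] := edge_ends g.
  have : a \in [set c; d] by rewrite -gE' gE !inE eqxx.
  move: gE; rewrite gE' !inE => + /orP[]/eqP ac; rewrite -{}ac in cd *.
    by move=> /set2_inj <-.
  by rewrite [in LHS]finset.setUC => /set2_inj <-; rewrite adj_sym.
have rp : cycle r p.
  apply/cycle_zip => a b ab.
  have [g gE] : exists g : edge G, val g = [set a; b].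
    by apply: edgeP; exact: (cycle_zip _ _).1 ab.
  apply/exists_inP; exists g; last exact/eqP.
  by rewrite FE inE gE; apply/mapP; exists (a, b).
have /connectP[q0 pq0 vE0] : connect r u v.
  have [i s pE] := rot_to up.
  move: rp; rewrite -(rot_cycle i) pE => /path_connect; apply.
  by rewrite -cats1 -cat_cons mem_cat -pE mem_rot vp.
(* Removing the loops of the walk from u to v gives a simple path. *)
case/shortenP: pq0 vE0 => q pq Uq _ vE {q0}.
have zE : zip (u :: q) (rot 1 (u :: q)) = rcons (zip (belast u q) q) (v, u).
  by rewrite rot1_cons lastI -vE zip_rcons ?size_belast.
have cq : cycle (@adj G) (u :: q).
  rewrite /= rcons_path -vE adj_sym uv andbT.
  exact: sub_path pq.
exists (walk_edges (u :: q)); split.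
- exists [set x in u :: q]; apply: ucycle_is_cycle => //.
  (* A path with fewer than two edges would be empty, making f a loop, or
     consist of f itself, which is not in F. *)
  case: q pq vE {Uq zE cq} => [|a [|//]] /=.
    by move=> _ vE; rewrite vE adj_irrefl in uv.
  rewrite andbT => /exists_inP[g gF /eqP gE] vE.
  by rewrite -vE -fE in gE; rewrite -(val_inj gE) gF in fF.
- rewrite inE zE; apply/mapP; exists (v, u); first by rewrite mem_rcons mem_head.
  by rewrite fE finset.setUC.
apply/fintype.subsetP => g; rewrite inE zE => /mapP[[a b]].
rewrite mem_rcons inE => /orP[/eqP[-> ->] gE|ab gE].
  by rewrite !inE -(inj_eq val_inj) fE gE finset.setUC eqxx.
have : r a b.
  apply: (path_zip r u q).1 pq _ _ _.
  by rewrite lastI -cats1 -[X in zip _ X]cats0 zip_cat ?size_belast // mem_cat ab.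
move=> /exists_inP[h hF /eqP hE]; rewrite -gE in hE.
by rewrite inE -(val_inj hE) hF orbT.
Qed.

Lemma is_cycle_induced_sub (G : sgraph) (W : {set G}) (F : {set edge G}) :
  is_cycle W F -> F \subset induced_edges W.
Proof.
move=> [p [_ _ -> -> _]]; apply/fintype.subsetP => g gp.
by rewrite inE; apply/fintype.subsetP => x xg; rewrite inE (walk_edges_ends gp xg).
Qed.

(** The induction runs over the whole cycle space, because the two pieces into
    which an even set is cut are again even but need not both be cycles. *)
Lemma even_no_strict_min (G : sgraph) (d : Order.disp_t) (T : orderType d)
    (x : edge G -> T) :
  (forall C, induced_cycles G C -> forall e, e \in C ->
    exists g, [/\ g \in C, g != e & (x g <= x e)%O]) ->
  forall F, even_edge_set F -> forall e, e \in F ->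
    exists g, [/\ g \in F, g != e & (x g <= x e)%O].
Proof.
move=> ind F; have [n] := ubnP #|F|; elim: n F => // n IH F Fn evF e eF.
have F0 : F <> finset.set0 by move=> F0; rewrite F0 inE in eF.
have [x0|C cC CF] := exists_cycle F0.
  by apply: contraNneq (evF x0) => ->.
have evC := cycle_even cC.
(* If the cycle C is a proper subset of F, then F is the disjoint union of the
   smaller even sets C and symdiff F C. *)
have [CE|CneF] := eqVneq C F; last first.
  have [f fC] : exists f, f \in C.
    by apply/finset.set0Pn; apply/eqP => C0; apply: (@cycle_neq0 G); rewrite -C0.
  have cardC : #|C| < n.
    apply: leq_trans (_ : #|F| <= n) => //.
    by rewrite proper_card // finset.properEneq CneF.
  have [eC|eC] := boolP (e \in C).
    have [g [gC ge xg]] := IH C cardC evC e eC.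
    by exists g; split=> //; apply: (fintype.subsetP CF).
  have cardD : #|symdiff F C| < n.
    have := card_symdiff F C; rewrite (finset.setIidPr CF).
    by have := even_card evC fC; move: Fn; lia.
  have eD : e \in symdiff F C by rewrite in_symdiff eF (negbTE eC).
  have [g [gD ge xg]] := IH _ cardD (even_symdiff evF evC) e eD.
  exists g; split=> //; move: gD; rewrite in_symdiff.
  by have := fintype.subsetP CF g; case: (g \in C) => [->|_]; rewrite ?addbF.
move: cC; rewrite {}CE => -[W cW] {C CF evC}.
(* From here on, F is itself a cycle; it is induced unless it has a chord f. *)
have [sW|] := boolP (induced_edges W \subset F).
  have FE : F = induced_edges W.
    by apply/eqP; rewrite finset.eqEsubset sW is_cycle_induced_sub.
  by apply: ind => //; exists W; rewrite -?FE.
case/fintype.subsetPn => f fW fF.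
have [C [cC fC CF]] := chord_cycle cW fW fF.
have evC := cycle_even cC.
have evD := even_symdiff evF evC.
have fD : f \in symdiff F C by rewrite in_symdiff (negbTE fF) fC.
have cardI : #|F :&: C| = #|C|.-1.
  rewrite (cardsD1 f C) fC; apply: eq_card => g; rewrite !inE.
  have := fintype.subsetP CF g; rewrite !inE.
  have [->|_] /= := eqVneq g f; first by rewrite (negbTE fF).
  by case: (g \in C) => [->|_]; rewrite ?andbF.
have cC3 := even_card evC fC; have cD3 := even_card evD fD.
have cardE := card_symdiff F C; rewrite cardI in cardE.
have Cn : #|C| < n by move: Fn cardE cC3 cD3; lia.
have Dn : #|symdiff F C| < n by move: Fn cardE cC3 cD3; lia.
have CF' g : g \in C -> g != f -> g \in F.
  by move=> /(fintype.subsetP CF); rewrite !inE => /orP[->|].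
have DF' g : g \in symdiff F C -> g != f -> g \in F.
  rewrite in_symdiff => gD gf; move: (CF' g) gD.
  by case: (g \in C) => [->|_]; rewrite ?addbF.
(* The two even sets C and symdiff F C play symmetric parts: K is the one that
   contains e and K' the other one, where the edge f can be replaced. *)
have combine (K K' : {set edge G}) : (forall g, g \in K -> g != f -> g \in F) ->
    (forall g, g \in K' -> g != f -> g \in F) -> #|K| < n -> #|K'| < n ->
    even_edge_set K -> even_edge_set K' -> f \in K' -> e \in K -> e \notin K' ->
    exists g, [/\ g \in F, g != e & (x g <= x e)%O].
  move=> KF KF' Kn Kn' evK evK' fK' eK eK'.
  have [h [hK he xh]] := IH K Kn evK e eK.
  have [hf|hf] := eqVneq h f; last by exists h; split=> //; apply: KF.
  have [g [gK' gf xg]] := IH K' Kn' evK' f fK'.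
  exists g; split; first exact: KF'.
    by apply: contraNneq eK' => <-.
  by apply: le_trans xg _; rewrite -hf.
have [eC|eC] := boolP (e \in C).
  by apply: (combine C (symdiff F C)) => //; rewrite in_symdiff eF eC.
by apply: (combine (symdiff F C) C) => //; rewrite in_symdiff eF (negbTE eC).
Qed.

(** In this form the condition speaks of one edge at a time, which suits the
    induction; conversely a minimizer and the element that it yields are two
    minimizers. *)
Lemma min_attained_twiceP (R : realType) (E : finType) (C : {set E})
    (x : trop_cone R E) :
  C <> finset.set0 ->
  min_attained_twice C x <-> (forall e, e \in C ->
    exists g, [/\ g \in C, g != e & (coord x g <= coord x e)%O]).
Proof.
move=> C0; split=> [[i [j [iC jC ij mi mj]]] e eC|h].
  have [ie|ie] := eqVneq i e; last by exists i; split=> //; apply: mi.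
  by exists j; split=> //; [rewrite eq_sym -ie|apply: mj].
have [i0 i0C] : exists i, i \in C by apply/finset.set0Pn/eqP.
case: (arg_minP (coord x) i0C) => i iC mi.
have [j [jC ji xj]] := h i iC.
exists i, j; split=> // [|k kC]; first by rewrite eq_sym.
exact: le_trans xj (mi k kC).
Qed.

Lemma trop_varietyE (R : realType) (E : finType) (B : set {set E})
    (x : trop_cone R E) :
  trop_variety R B (\pi_(TP R E) x)%qT <->
  forall C, B C -> min_attained_twice C x.
Proof.
by split=> h C BC; [apply/trop_circuitE/h|apply/trop_circuitE/h].
Qed.

Lemma induced_is_cycle (G : sgraph) (C : {set edge G}) :
  induced_cycles G C -> cycle_edge_sets G C.
Proof. by move=> [W cW ->]; exists W. Qed.

Lemma cycle_nonempty (G : sgraph) (C : {set edge G}) :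
  cycle_edge_sets G C -> C <> finset.set0.
Proof. by move=> + C0; rewrite C0; exact: cycle_neq0. Qed.

Lemma induced_tropical_basis (R : realType) (G : sgraph) :
  tropical_basis R (graphic_matroid G) (induced_cycles G).
Proof.
split; first exact: induced_is_cycle.
apply/seteqP; split=> p; rewrite -(reprK p) => /trop_varietyE h.
  apply/trop_varietyE => C cC.
  apply/(min_attained_twiceP _ (cycle_nonempty cC)).
  apply: even_no_strict_min (cycle_even cC) => D iD.
  apply/(min_attained_twiceP _ (cycle_nonempty (induced_is_cycle iD))).
  exact: h.
by apply/trop_varietyE => C /induced_is_cycle; apply: h.
Qed.

(** * Every induced cycle is needed *)

(** An edge f of D outside C is not spanned by the vertices of C, since C is
    induced.  An end of f that is not a vertex of C meets a second edge of D,
    which lies outside C as well. *)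
Lemma induced_cycle_two_outside (G : sgraph) (C D : {set edge G}) :
  induced_cycles G C -> cycle_edge_sets G D -> D <> C ->
  exists f g, [/\ f \in D :\: C, g \in D :\: C & f != g].
Proof.
move=> iC cD DC; have [W cW CE] := iC.
have [f fD fC] : exists2 f, f \in D & f \notin C.
  apply/fintype.subsetPn/negP => DsC; apply: DC.
  exact: cycle_antichain cD (induced_is_cycle iC) DsC.
have [x xf xW] : exists2 x, x \in val f & x \notin W.
  by apply/fintype.subsetPn; move: fC; rewrite CE inE.
have [g [gD gf xg]] := even_other_edge (cycle_even cD) fD xf.
exists f, g; rewrite !inE fC fD gD eq_sym gf; split=> //=.
by rewrite andbT CE inE; apply: contra xW => /fintype.subsetP/(_ x xg).
Qed.

Lemma trop_cone_of_bool (R : realType) (E : finType) (b : pred E) (e : E) :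
  exists x : trop_cone R E, forall i, coord x i = ((b i)%:R : R)%:E.
Proof.
have nb (i : E) : ((b i)%:R : R)%R%:E != -oo%E by [].
pose y : {ffun E -> trop R} :=
  [ffun i => exist (fun z : \bar R => z != -oo%E) _ (nb i)].
have y_fin : [exists i, val (y i) != +oo%E].
  by apply/existsP; exists e; rewrite ffunE.
exists (exist (fun z : {ffun E -> trop R} => [exists i, val (z i) != +oo%E]) _ y_fin).
by move=> i; rewrite /coord /= ffunE.
Qed.

(** The point that is 1 on C minus one edge and 0 elsewhere lies on the tropical
    hypersurfaces of all cycles except C. *)
Lemma induced_sub_tropical_basis (R : realType) (G : sgraph)
    (B : set {set edge G}) :
  tropical_basis R (graphic_matroid G) B -> (induced_cycles G `<=` B)%classic.
Proof.
move=> [Bc BE] C iC; apply: contrapT => nBC.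
have cC := induced_is_cycle iC.
have /eqP/finset.set0Pn[e eC] := cycle_nonempty cC.
have [x xE] := trop_cone_of_bool R (fun i => (i \in C) && (i != e)) e.
have x_ge0 i : (0%:E <= coord x i)%E by rewrite xE lee_fin Num.Theory.ler0n.
have : trop_variety R B (\pi_(TP R (edge G)) x)%qT.
  apply/trop_varietyE => D BD.
  have DC : D <> C by move=> DC; rewrite DC in BD.
  have [f [g [fD gD fg]]] := induced_cycle_two_outside iC (Bc _ BD) DC.
  move: fD gD; rewrite !inE => /andP[fC fD] /andP[gC gD].
  by exists f, g; split=> // k _; rewrite xE ?(negbTE fC) ?(negbTE gC) x_ge0.
rewrite BE => /trop_varietyE/(_ C cC).
move/(min_attained_twiceP _ (cycle_nonempty cC))/(_ e eC) => [g [gC ge]].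
by rewrite !xE gC ge eqxx andbF lee_fin Num.Theory.ler10.
Qed.

(** * The unique minimal tropical basis *)

Theorem theorem8 (R : realType) (G : sgraph) :
  unique (minimal_tropical_basis R (graphic_matroid G)) (induced_cycles G).
Proof.
split.
  split=> [|B tB BI]; first exact: induced_tropical_basis.
  by apply/seteqP; split=> //; exact: induced_sub_tropical_basis tB.
move=> B [tB minB]; apply: minB (induced_tropical_basis R G) _.
exact: induced_sub_tropical_basis tB.
Qed.
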